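(* For every integer $n\geq 3$, there exist a temporal cycle $\mathcal{C}$ with $n$ vertices and lifetime $L\geq 2n-2$, and a starting vertex $s$, such that every exploration of $\mathcal{C}$ starting at $s$ traverses at least $\lfloor \frac{3}{2}(n-1)\rfloor$ edges.
   Context: A temporal graph $\mathcal{G}$ with (finite) vertex set $V$, $|V|=n$, and lifetime $L$ is a sequence $(G_1,\dots,G_L)$ of static undirected graphs $G_i=(V,E_i)$; $G_i$ is the snapshot at time step $i$. All temporal graphs are assumed constantly connected: every $G_i$ is connected. The underlying graph is $(V,\bigcup_i E_i)$. A temporal cycle is a (constantly connected) temporal graph whose underlying graph is a cycle on the $n\ge 3$ vertices. A (strict) journey from $u$ to $v$ is a sequence $((v_0,v_1),t_1),\dots,((v_{l-1},v_l),t_l)$ with $v_0=u$, $v_l=v$, $1\le t_1<t_2<\dots<t_l\le L$ (not necessarily consecutive) and $\{v_{i-1},v_i\}\in E_{t_i}$ for all $i$. The number of edges traversed is $l$, counted with multiplicity. The journey visits the vertices $v_0,\dots,v_l$. An exploration starting at $s$ is a strict journey with $v_0=s$ that visits all vertices of $V$. *)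

(* Defs.v *)
From mathcomp Require Import all_boot.

Set Implicit Arguments.
Unset Strict Implicit.
Unset Printing Implicit Defensive.

Record sgraph (V : finType) := SGraph {
  edge :> rel V;
  edge_sym : symmetric edge;
  edge_irr : irreflexive edge }.

Definition connected_graph (V : finType) (e : rel V) : Prop :=
  forall x y : V, connect e x y.

(* The vertices can be arranged as a cyclic sequence [c] of length at least 3,
   without repetition, such that the edges are exactly the pairs of cyclically
   consecutive vertices. *)
Definition cycle_graph (V : finType) (e : rel V) : Prop :=
  exists c : seq V,
    [/\ 3 <= size c, uniq c, (forall x : V, x \in c) &
        forall x y : V, e x y = (y == next c x) || (x == next c y)].

(* Time steps are indexed from 0: the ordinal [i] stands for time step [i.+1].
   Constant connectivity is part of the structure. *)
Record tgraph (V : finType) := TGraph {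
  lifetime : nat;
  snapshot : 'I_lifetime -> sgraph V;
  snapshot_connected : forall i, connected_graph (snapshot i) }.

Section TemporalGraph.
Variables (V : finType) (G : tgraph V).

Definition underlying : rel V :=
  fun x y => [exists i : 'I_(lifetime G), snapshot i x y].

Definition temporal_cycle : Prop := cycle_graph underlying.

(* [((x, y), t)]: traversal of the edge {x, y} from x to y at time t. *)
Definition tstep : Type := ((V * V) * 'I_(lifetime G))%type.

Definition source (a : tstep) : V := a.1.1.
Definition target (a : tstep) : V := a.1.2.
Definition time (a : tstep) : 'I_(lifetime G) := a.2.

(* [v_0; v_1; ...; v_l] for a journey [J] starting at [v_0 = u]. *)
Definition visited (u : V) (J : seq tstep) : seq V := u :: map target J.

(* Each step starts where the previous one ends, the first one at [u]. *)
Fixpoint chained (u : V) (J : seq tstep) : bool :=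
  if J is a :: J' then (source a == u) && chained (target a) J' else true.

Definition journey (u v : V) (J : seq tstep) : Prop :=
  [/\ chained u J,
      last u (map target J) = v,
      sorted ltn [seq val (time a) | a <- J] &
      forall a, a \in J -> snapshot (time a) (source a) (target a)].

Definition exploration (s : V) (J : seq tstep) : Prop :=
  (exists v : V, journey s v J) /\ (forall x : V, x \in visited s J).

Definition traversed (J : seq tstep) : nat := size J.

End TemporalGraph.

(* Main.v *)
(** On a path, an exploration from the middle vertex must reach both ends, hence
    turns back at one of them and takes at least (n-1)/2 + (n-1) steps. The
    closing edge of the cycle is present only at the first time step, when the
    explorer is at the middle vertex and cannot use it. *)
Require Import Defs.
From mathcomp Require Import all_boot.
From mathcomp Require Import zify.

Section MiddleStart.

Set Implicit Arguments.
Unset Strict Implicit.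

Variable m : nat.
Local Notation V := 'I_m.+3.

Definition path_rel : rel V := fun x y => (y == x.+1 :> nat) || (x == y.+1 :> nat).

Definition cycle_rel : rel V := fun x y => (y == ordS x) || (x == ordS y).

Lemma path_rel_sym : symmetric path_rel.
Proof. by move=> x y; rewrite /path_rel orbC. Qed.

Lemma path_rel_irr : irreflexive path_rel.
Proof. by move=> x; rewrite /path_rel; lia. Qed.

Lemma cycle_rel_sym : symmetric cycle_rel.
Proof. by move=> x y; rewrite /cycle_rel orbC. Qed.

Lemma val_ordS (x : V) : ordS x = (if x == m.+2 :> nat then 0 else x.+1) :> nat.
Proof.
rewrite /=; case: eqP => [->|xm]; first by rewrite modnn.
by rewrite modn_small //; have := ltn_ord x; lia.
Qed.

(** Turns the cyclic successor into a conditional on [nat], free of modulus, so that [lia] can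
    decide adjacency. *)
Lemma eq_ordS (x y : V) :
  (y == ordS x) = (y == (if x == m.+2 :> nat then 0 else x.+1) :> nat).
Proof. by rewrite -val_ordS. Qed.

Lemma cycle_rel_irr : irreflexive cycle_rel.
Proof.
move=> x; rewrite /cycle_rel orbb eq_ordS.
by case: ifP; lia.
Qed.

Lemma path_rel_cycle (x y : V) : path_rel x y -> cycle_rel x y.
Proof.
rewrite /cycle_rel !eq_ordS /path_rel.
have := ltn_ord x; have := ltn_ord y.
by do 2 case: ifP; lia.
Qed.

(** The only edge of the cycle outside the path joins [0] and [m.+2], so an interior vertex has the
    same neighbours in both. *)
Lemma cycle_rel_path (x y : V) :
  0 < x < m.+2 -> cycle_rel x y -> path_rel x y.
Proof.
rewrite /cycle_rel !eq_ordS /path_rel.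
have := ltn_ord x; have := ltn_ord y.
by do 2 case: ifP; lia.
Qed.

Lemma next_enum_ord (x : V) : next (enum V) x = ordS x.
Proof.
apply: ord_inj; rewrite val_ordS next_nth mem_enum inE index_enum_ord.
case E: (enum V) => [|y p]; first by have := size_enum_ord m.+3; rewrite E.
have yE : y = ord0.
  by apply: val_inj; rewrite /= -(@nth_enum_ord m.+3 ord0 0) // E.
have sp : size p = m.+2 by have := size_enum_ord m.+3; rewrite E => -[].
(* At the last vertex the index is out of range in [p], and the default [y], which is [ord0], gives
   the wrap-around. *)
case: eqP => [->|xm]; first by rewrite nth_default ?sp // yE.
have xlt : x.+1 < m.+3 by have := ltn_ord x; lia.
by rewrite -[RHS](@nth_enum_ord m.+3 y x.+1) // E.
Qed.

Lemma cycle_rel_cycle_graph : cycle_graph cycle_rel.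
Proof.
exists (enum V); split; first by rewrite size_enum_ord.
- exact: enum_uniq.
- by move=> x; rewrite mem_enum.
- by move=> x y; rewrite !next_enum_ord.
Qed.

Lemma path_rel_connected : connected_graph path_rel.
Proof.
have from0 k (kn : k < m.+3) : connect path_rel ord0 (Ordinal kn).
  elim: k kn => [|k IHk] kn; first by rewrite (_ : Ordinal kn = ord0) //; apply: val_inj.
  apply: connect_trans (IHk (ltnW kn)) (connect1 _).
  by rewrite /path_rel /= eqxx.
move=> [x xn] y; apply: (@connect_trans _ _ ord0); last by case: y => y yn.
by rewrite (sym_connect_sym path_rel_sym).
Qed.

Lemma cycle_rel_connected : connected_graph cycle_rel.
Proof.
move=> x y; apply: connect_sub (path_rel_connected x y) => u v uv.
exact/connect1/path_rel_cycle.
Qed.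

(** With truncated subtraction, the sum is the absolute difference of [x] and [y], which one step
    changes by 1. *)
Lemma path_rel_dist (x y : V) (p : seq V) :
  path path_rel x p -> y \in x :: p -> (x - y) + (y - x) <= size p.
Proof.
elim: p x => [|z p IHp] x /=; first by rewrite inE => _ /eqP ->; lia.
case/andP=> xz zp; rewrite inE => /predU1P[->|/(IHp _ zp)]; first by lia.
by move: xz; rewrite /path_rel; lia.
Qed.

(** The walk first reaches the nearer of [y] and [z] or a farther one, and from there must still
    cover the distance between them. *)
Lemma path_rel_dist2 (x y z : V) (p : seq V) :
  path path_rel x p -> y \in x :: p -> z \in x :: p ->
  (y - z) + (z - y) +
    minn ((x - y) + (y - x)) ((x - z) + (z - x)) <= size p.
Proof.
elim: p x => [|w p IHp] x xp.
  by rewrite !inE => /eqP -> /eqP ->; lia.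
(* If [x] is one of the two targets, the minimum vanishes and [path_rel_dist] suffices. Otherwise
   one step lowers the minimum by at most 1. *)
rewrite 2!(in_cons x) => /predU1P[->|yp] /predU1P[->|zp]; first by lia.
- have zp' : z \in [:: x, w & p] by rewrite inE zp orbT.
  by have := path_rel_dist xp zp'; lia.
- have yp' : y \in [:: x, w & p] by rewrite inE yp orbT.
  by have := path_rel_dist xp yp'; lia.
case/andP: xp => xw wp; have := IHp _ wp yp zp.
by move: xw; rewrite /path_rel /=; lia.
Qed.

(** Indexed by [nat] so that it does not depend on the lifetime; index 0 is the first time step. *)
Definition closing_edge_once (i : nat) : sgraph V :=
  if i == 0 then SGraph cycle_rel_sym cycle_rel_irr
  else SGraph path_rel_sym path_rel_irr.

Lemma closing_edge_once_connected (i : nat) :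
  connected_graph (closing_edge_once i).
Proof.
rewrite /closing_edge_once; case: eqP => _.
  exact: cycle_rel_connected.
exact: path_rel_connected.
Qed.

Definition closing_edge_once_tgraph (L : nat) : tgraph V :=
  @TGraph V L (fun i => closing_edge_once i)
    (fun i => closing_edge_once_connected i).

Lemma closing_edge_once_temporal_cycle (L : nat) :
  0 < L -> temporal_cycle (closing_edge_once_tgraph L).
Proof.
move=> L0; have [c [c3 cu cV cE]] := cycle_rel_cycle_graph.
exists c; split=> // x y; rewrite -cE; apply/existsP/idP => /= [[i]|xy].
  rewrite /closing_edge_once; case: eqP => // _; exact: path_rel_cycle.
by exists (Ordinal L0).
Qed.

Lemma chained_path (G : tgraph V) (u : V) (J : seq (tstep G)) :
  chained u J -> {in J, forall a, path_rel (source a) (target a)} ->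
  path path_rel u (map (@target V G) J).
Proof.
elim: J u => //= a J IHJ u /andP[/eqP <- aJ] adj.
rewrite adj ?mem_head //= IHJ // => b bJ.
by apply: adj; rewrite inE bJ orbT.
Qed.

(** Times increase strictly, so only the first step can occur at time 0, and it leaves from the
    interior vertex [u], which is not on the closing edge. *)
Lemma journey_path (L : nat) (u v : V)
    (J : seq (tstep (closing_edge_once_tgraph L))) :
  0 < u < m.+2 -> journey u v J ->
  path path_rel u (map (@target V _) J).
Proof.
move=> uP [Jc _ Jt Je]; apply: chained_path => // a aJ.
case: J Jc Jt Je aJ => //= b J /andP[/eqP bu _] Jt Je aJ.
have := Je a aJ; rewrite /= /closing_edge_once; case: eqP => // a0.
apply: cycle_rel_path.
move: aJ; rewrite inE => /predU1P[->|aJ]; first by rewrite bu.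
(* A later step has a time above that of [b], hence not 0. *)
have /allP/(_ _ (map_f _ aJ)) := order_path_min ltn_trans Jt.
by rewrite /= a0 ltn0.
Qed.

End MiddleStart.

Theorem lemma17 (n : nat) (hn : 3 <= n) :
  exists (V : finType) (C : tgraph V) (s : V),
    [/\ #|V| = n,
        temporal_cycle C,
        2 * n - 2 <= lifetime C &
        forall J : seq (tstep C),
          exploration s J -> (3 * (n - 1)) %/ 2 <= traversed J].
Proof.
case: n hn => [|[|[|m]]] // _.
(* With [n = m.+3], the start is the middle vertex, at distance [(n - 1) %/ 2] from the nearer
   end. *)
have sn : m.+2 %/ 2 < m.+3 by lia.
exists 'I_m.+3, (closing_edge_once_tgraph m (2 * m.+3 - 2)), (Ordinal sn).
split=> //; first exact: card_ord.
  by apply: closing_edge_once_temporal_cycle; lia.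
move=> J [[v Jv] Jall].
have sP : 0 < Ordinal sn < m.+2 by rewrite /=; lia.
(* The ends are [n - 1] apart, and [(n - 1) + (n - 1) %/ 2] equals [(3 * (n - 1)) %/ 2]. *)
have := path_rel_dist2 (journey_path sP Jv) (Jall ord0) (Jall ord_max).
by rewrite size_map /traversed /=; lia.
Qed.
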